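(* Let $T_1$ and $T_2$ be the lifetimes of two coherent systems with identically distributed components and with distortion functions $q_1$ and $q_2$, respectively. Let $\phi(u)=\frac{1-u^2}{2}$ for $0<u<1$. Then $$D_1\,\bar\eta^1J(T_1)\le \bar\eta^1J(T_2)\le D_2\,\bar\eta^1J(T_1),$$ where $D_1=\inf_{u\in(0,1)}\left(\frac{\phi(q_2(u))}{\phi(q_1(u))}\right)$ and $D_2=\sup_{u\in(0,1)}\left(\frac{\phi(q_2(u))}{\phi(q_1(u))}\right)$.
   Context: For a non-negative absolutely continuous random variable $Z$ with cumulative distribution function $F_Z$, the weighted negative cumulative extropy is $$\bar\eta^1J(Z)=\frac12\int_0^\infty x\,(1-F_Z^2(x))\,dx .$$ A coherent system is a system with a monotone structure function and without irrelevant components. For a coherent system with identically distributed components having common cumulative distribution function $F$, the system lifetime $T$ has cumulative distribution function $F_T(x)=q(F(x))$, where the distortion function $q$ is an increasing continuous function on $[0,1]$ with $q(0)=0$ and $q(1)=1$, which depends only on the structure of the system and the copula of the random vector of component lifetimes. *)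

(* Defs.v *)
(* MathComp / MathComp-Analysis *)
From HB Require Import structures.
From mathcomp Require Import all_boot all_order all_algebra.
From mathcomp Require Import all_classical all_reals all_analysis.

Set Implicit Arguments.
Unset Strict Implicit.
Unset Printing Implicit Defensive.

Import Order.TTheory GRing.Theory Num.Theory.
Import numFieldNormedType.Exports.

Local Open Scope classical_set_scope.
Local Open Scope ring_scope.

Section coherent_system.
Context (n : nat).

(* [true] means that a component (or the system) works. *)
Implicit Types (psi : {ffun 'I_n -> bool} -> bool) (s t : {ffun 'I_n -> bool}).

Definition monotone_structure psi : Prop :=
  forall s t, (forall i, s i -> t i) -> psi s -> psi t.

Definition set_state s (i : 'I_n) (b : bool) : {ffun 'I_n -> bool} :=
  [ffun j => if j == i then b else s j].

Definition relevant psi (i : 'I_n) : Prop :=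
  exists s, psi (set_state s i true) != psi (set_state s i false).

Definition coherent psi : Prop :=
  monotone_structure psi /\ forall i, relevant psi i.

(* The system works at time t iff the structure function is true at the states
   of its components at time t.  This determines L pointwise. *)
Definition system_lifetime (Omega : Type) (R : realType) psi
    (X : 'I_n -> Omega -> R) (L : Omega -> R) : Prop :=
  forall w (t : R), (t < L w) = psi [ffun i => t < X i w].

End coherent_system.

Section random_lifetimes.
Context (d : measure_display) (Omega : measurableType d) (R : realType).
Context (P : probability Omega R).

Definition nonneg_rv (Z : {RV P >-> R}) : Prop := {ae P, forall w, 0 <= Z w}.

Definition abs_continuous_rv (Z : {RV P >-> R}) : Prop :=
  distribution P Z `<< (@lebesgue_measure R).

Definition weighted_neg_cumul_extropy (Z : {RV P >-> R}) : \bar R :=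
  ((2^-1)%:E * \int[@lebesgue_measure R]_(x in `[0%R, +oo[)
    (x%:E * (1 - cdf Z x ^+ 2)))%E.

(* q is only constrained on [0, 1]; "increasing" is not required to be strict,
   since a singular copula can make q constant on a subinterval. *)
Definition distortion (q : R -> R) (F : R -> R) (Z : {RV P >-> R}) : Prop :=
  [/\ {in `[0, 1] &, {homo q : u v / u <= v}},
      {within `[0, 1], continuous q},
      q 0 = 0, q 1 = 1 &
      forall x, cdf Z x = (q (F x))%:E].

Definition coherent_lifetime (n : nat) (psi : {ffun 'I_n -> bool} -> bool)
    (F : R -> R) (X : 'I_n -> {RV P >-> R}) (L : {RV P >-> R}) : Prop :=
  [/\ coherent psi,
      forall i, nonneg_rv (X i),
      forall i x, cdf (X i) x = (F x)%:E &
      system_lifetime psi (fun i => X i : Omega -> R) L].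

End random_lifetimes.

Definition phi (R : realType) (u : R) : R := (1 - u ^+ 2) / 2.

(* The quotients are those with nonzero denominator; phi (q1 u) = 0 can only
   happen when q1 reaches 1 before u = 1, and the condition is void when q1 is
   strictly increasing.  The set is embedded in the extended reals because it
   may be unbounded above. *)
Definition phi_quotients (R : realType) (q1 q2 : R -> R) : set (\bar R) :=
  [set (phi (q2 u) / phi (q1 u))%:E
    | u in [set u : R | 0 < u < 1 /\ phi (q1 u) != 0]].

(* Main.v *)
(* The extropy of T_i is the integral over x >= 0 of x phi(q_i(F x)), so it
   suffices to compare phi(q_1 u) and phi(q_2 u) for every u in [0, 1].  On
   (0, 1), away from the zeros of phi o q_1, the comparison is the definition of
   D_1 and D_2.  At u = 0 the ratio is 1 and continuity of the distortions gives
   D_1 <= 1 <= D_2.  If phi o q_1 vanishes at a point where phi o q_2 does not,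
   then the quotients are unbounded and D_2 = +oo; the upper bound then holds
   because the extropy of T_1 is positive, T_1 being nonnegative with no atom
   at 0. *)
Require Import Defs.
From HB Require Import structures.
From mathcomp Require Import all_boot all_order all_algebra.
From mathcomp Require Import all_classical all_reals all_analysis.
From mathcomp Require Import measurable_realfun ring lra.

Import Order.TTheory GRing.Theory Num.Theory.
Import numFieldNormedType.Exports.

Set Implicit Arguments.
Unset Strict Implicit.

Local Open Scope classical_set_scope.
Local Open Scope ring_scope.

(** * Pointwise comparison of [phi (q1 u)] and [phi (q2 u)] on [0, 1] *)

Section phi_bounds.
Context (R : realType).
Implicit Types (q : R -> R) (u v D : R).

Lemma phi_ge0 u : 0 <= u <= 1 -> 0 <= phi u.
Proof. by move=> u01; rewrite /phi; nra. Qed.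

Lemma phi_neq0 u : 0 <= u < 1 -> phi u != 0.
Proof. by move=> u01; apply: lt0r_neq0; rewrite /phi; nra. Qed.

Lemma continuous_attains q u0 v :
    {within `[0, 1], continuous q} -> q 0 = 0 -> 0 <= u0 <= 1 ->
    0 <= v <= q u0 ->
  exists2 u, 0 <= u <= u0 & q u = v.
Proof.
move=> qc q0 /andP[u00 u01] /andP[v0 vq].
have qc' : {within `[0, u0], continuous q}.
  apply: continuous_subspaceW qc => x /=; rewrite !in_itv/= => /andP[-> xu] /=.
  exact: le_trans xu u01.
have [|u] := @IVT _ _ _ _ v u00 qc'.
  by rewrite q0 min_l ?max_r ?v0// (le_trans v0 vq).
by rewrite in_itv/= => u0u <-; exists u.
Qed.

Lemma continuous_attains_interior q v :
    {within `[0, 1], continuous q} -> q 0 = 0 -> q 1 = 1 -> 0 < v < 1 ->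
  exists2 u, 0 < u < 1 & q u = v.
Proof.
move=> qc q0 q1 /andP[v0 v1].
have [||u /andP[u0 u1] quv] := continuous_attains (u0 := 1) (v := v) qc q0.
- by rewrite ler01 lexx.
- by rewrite q1 !ltW.
exists u => //; rewrite !lt_neqAle u0 u1 !andbT; apply/andP; split.
  by apply/eqP => uE; move: v0; rewrite -quv -uE q0 ltxx.
by apply/eqP => uE; move: v1; rewrite -quv uE q1 ltxx.
Qed.

Lemma homo_itv01 q u : {in `[0, 1] &, {homo q : u v / u <= v}} ->
  q 0 = 0 -> q 1 = 1 -> 0 <= u <= 1 -> 0 <= q u <= 1.
Proof.
move=> qnd q_0 q_1 u01; rewrite -{1}q_0 -q_1; case/andP: (u01) => u0 u1.
by rewrite !qnd// ?in_itv/= ?lexx ?ler01 ?u0.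
Qed.

Variables q1 q2 : R -> R.
Hypothesis q1_nd : {in `[0, 1] &, {homo q1 : u v / u <= v}}.
Hypothesis q2_nd : {in `[0, 1] &, {homo q2 : u v / u <= v}}.
Hypothesis q1_cont : {within `[0, 1], continuous q1}.
Hypothesis q2_cont : {within `[0, 1], continuous q2}.
Hypotheses (q10 : q1 0 = 0) (q11 : q1 1 = 1) (q20 : q2 0 = 0) (q21 : q2 1 = 1).

(** At u = 1 and at the zeros of [phi \o q1] the left side vanishes while the right side is
    nonnegative. Only u = 0 needs an argument: there the claim amounts to D <= 1. *)
Lemma phi_lower_bound D :
    (forall u, 0 < u < 1 -> phi (q1 u) != 0 -> D * phi (q1 u) <= phi (q2 u)) ->
  forall u, 0 <= u <= 1 -> D * phi (q1 u) <= phi (q2 u).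
Proof.
move=> DP u /andP[]; rewrite le_eqVlt => /predU1P[<- _|u0].
  rewrite q10 q20 leNgt; apply/negP; rewrite /phi => D1.
  have D0 : 1 < D by nra.
  (* Chosen so that D (1 - v) = 1: where [q1] takes the value v, D (1 - v^2) = 1 + v > 1, whereas
     twice [phi (q2 w)] is at most 1. *)
  pose v := (D - 1) / D.
  have vD : v * D = D - 1 by rewrite /v divfK// gt_eqF//; lra.
  have v01 : 0 < v < 1 by nra.
  have [w w01 qw] := continuous_attains_interior q1_cont q10 q11 v01.
  have := DP _ w01; rewrite qw phi_neq0 => [/(_ isT)|]; last by nra.
  have := w01 => /andP[/ltW w0 /ltW w1].
  have := homo_itv01 (u := w) q2_nd q20 q21; rewrite w0 w1 => /(_ isT).
  by rewrite /phi; nra.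
rewrite le_eqVlt => /predU1P[->|u1]; first by rewrite q11 q21 /phi; lra.
have [p0|p0] := eqVneq (phi (q1 u)) 0; last by apply: DP => //; rewrite u0.
rewrite p0 mulr0; apply/phi_ge0/homo_itv01 => //.
by rewrite !ltW.
Qed.

(** Here the zeros of [phi \o q1] are the hard case: a finite D must force [phi \o q2] to vanish
    there as well. At u = 0 the claim amounts to D >= 1. *)
Lemma phi_upper_bound D :
    (forall u, 0 < u < 1 -> phi (q1 u) != 0 -> phi (q2 u) <= D * phi (q1 u)) ->
  forall u, 0 <= u <= 1 -> phi (q2 u) <= D * phi (q1 u).
Proof.
move=> DP.
(* Read off at a point where [q1] equals 1/2; it makes D + 1 a legitimate denominator below. *)
have D0 : 0 <= D.
  have h : 0 < (2^-1 : R) < 1 by apply/andP; split; lra.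
  have [w w01 qw] := continuous_attains_interior q1_cont q10 q11 h.
  have := DP _ w01; rewrite qw phi_neq0 => [/(_ isT)|]; last by lra.
  have : 0 <= phi (q2 w).
    by apply/phi_ge0/homo_itv01 => //; case/andP: w01 => *; rewrite !ltW.
  by rewrite /phi; nra.
(* A zero of [phi \o q1] is approached by values of [q1] just below 1, where the
   quotients would blow up if [phi \o q2] did not vanish there too. *)
have DP' u : 0 < u < 1 -> phi (q2 u) <= D * phi (q1 u).
  move=> /[dup] u01 /andP[u0 u1].
  have [p0|] := eqVneq (phi (q1 u)) 0; last exact: DP.
  have u01' : 0 <= u <= 1 by rewrite !ltW.
  have q1u := homo_itv01 q1_nd q10 q11 u01'.
  have q2u := homo_itv01 q2_nd q20 q21 u01'.
  have q1u1 : q1 u = 1 by move: p0; rewrite /phi; nra.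
  rewrite p0 mulr0 leNgt; apply/negP => c0.
  have c1 : phi (q2 u) <= 2^-1 by rewrite /phi; nra.
  set c := phi (q2 u) in c0 c1 *.
  (* Since [phi (1 - e) <= e], this gives [D * phi (1 - e) < c], while [phi (q2 w) >= c] for w <= u
     by monotonicity of [q2]. The bound c <= 1/2 ensures e < 1. *)
  pose e := c / (2 * (D + 1)).
  have eD : e * (2 * (D + 1)) = c by rewrite /e divfK// gt_eqF//; lra.
  have e0 : 0 < e by rewrite /e divr_gt0//; lra.
  have e1 : e < 1 by nra.
  have [|w /andP[w0 wu] qw] :=
    continuous_attains (v := 1 - e) q1_cont q10 u01'.
    by rewrite q1u1; lra.
  have wgt0 : 0 < w.
    rewrite lt_neqAle w0 andbT; apply/eqP => wE.
    by move: qw; rewrite -wE q10; lra.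
  have w1 : w < 1 by exact: le_lt_trans wu u1.
  have := DP w; rewrite wgt0 w1 qw phi_neq0; last by lra.
  move=> /(_ isT isT).
  have q2w : 0 <= q2 w <= q2 u.
    rewrite q2_nd ?in_itv/= ?w0 ?(ltW w1)// andbT.
    have w01 : 0 <= w <= 1 by rewrite w0 ltW.
    by have /andP[] := homo_itv01 q2_nd q20 q21 w01.
  have : c <= phi (q2 w).
    by rewrite ler_pM2r// lerB// ler_pXn2r ?nnegrE//; case/andP: q2w q2u; lra.
  have : phi (1 - e) <= e by rewrite /phi; nra.
  by nra.
move=> u /andP[]; rewrite le_eqVlt => /predU1P[<- _|u0].
  rewrite q10 q20 leNgt; apply/negP => D1.
  have D1' : D < 1 by move: D1; rewrite /phi; nra.
  (* The point w is now chosen through [q2], so [phi (q1 w)] may vanish and [DP'] is needed instead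
     of [DP]. It yields 1 - v^2 <= D = 1 - 2 v, impossible for 0 < v < 1. *)
  pose v := (1 - D) / 2.
  have v01 : 0 < v < 1 by rewrite /v; lra.
  have [w w01 qw] := continuous_attains_interior q2_cont q20 q21 v01.
  have := DP' _ w01; rewrite qw.
  have := w01 => /andP[/ltW w0 /ltW w1].
  have := homo_itv01 (u := w) q1_nd q10 q11; rewrite w0 w1 => /(_ isT).
  have vD : D = 1 - 2 * v by rewrite /v; field.
  rewrite /phi => q1w H.
  have : 1 - v ^+ 2 <= D by nra.
  by nra.
rewrite le_eqVlt => /predU1P[->|u1]; first by rewrite q11 q21 /phi; lra.
by apply: DP'; rewrite u0.
Qed.

End phi_bounds.

(** * The extropy as an integral of [phi], and its positivity *)

Section extropy.
Context (d : measure_display) (Omega : measurableType d) (R : realType).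
Context (P : probability Omega R).
Implicit Types (Z : {RV P >-> R}) (c : R -> R).

Lemma measurable_weighted_phi Z c : (forall x, cdf Z x = (c x)%:E) ->
  measurable_fun (`[0, +oo[ : set R) (fun x => (x * phi (c x))%:E).
Proof.
move=> cE; apply/measurable_EFinP/measurable_funM => //.
have mc : measurable_fun setT c.
  apply/measurable_EFinP; rewrite (_ : _ \o _ = cdf Z); last first.
    by apply/funext => x; rewrite cE.
  exact: cdf_measurable.
apply: (measurable_funS (E := setT)) => //.
apply: measurable_funM => //; apply: measurable_funB => //.
exact: measurable_funX.
Qed.

Lemma weighted_phi_ge0 Z c x : (forall x, cdf Z x = (c x)%:E) ->
  0 <= x -> 0 <= x * phi (c x).
Proof.
move=> cE x0; rewrite mulr_ge0// phi_ge0// -!lee_fin -cE.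
by rewrite cdf_ge0 cdf_le1.
Qed.

Lemma weighted_neg_cumul_extropyE Z c : (forall x, cdf Z x = (c x)%:E) ->
  weighted_neg_cumul_extropy Z =
    (\int[@lebesgue_measure R]_(x in `[0%R, +oo[) (x * phi (c x))%:E)%E.
Proof.
move=> cE; have E x : (x%:E * (1 - cdf Z x ^+ 2) = 2%:E * (x * phi (c x))%:E)%E.
  rewrite cE -EFin_expe -EFinB -!EFinM; congr EFin.
  by rewrite /phi; field.
rewrite /weighted_neg_cumul_extropy; under eq_integral do rewrite E.
rewrite ge0_integralZl//.
- by rewrite muleA -EFinM mulVf ?mul1e// pnatr_eq0.
- exact: measurable_weighted_phi cE.
- move=> x /=; rewrite in_itv/= andbT => x0.
  by rewrite lee_fin (weighted_phi_ge0 cE).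
Qed.

(** Right continuity keeps the cdf below 1 up to some b > 0. On [b/2, b], away from the zero of the
    weight x, the integrand is then bounded below by a positive constant. *)
Lemma weighted_neg_cumul_extropy_gt0 Z : (cdf Z 0 < 1)%E ->
  (0 < weighted_neg_cumul_extropy Z)%E.
Proof.
move=> Z0.
have cE x : cdf Z x = (fine (cdf Z x))%:E by rewrite fineK// fin_num_measure.
rewrite (weighted_neg_cumul_extropyE cE).
set c := fun x => fine (cdf Z x).
have [b b0 cb] : exists2 b : R, 0 < b & c b < 1.
  have lt1 : \forall x \near (0 : R)^'+, (cdf Z x < 1)%E.
    apply: (@cdf_right_continuous _ _ _ _ Z 0 [set y | (y < 1)%E]).
    exact: open_ereal_lt'.
  near (0 : R)^'+ => b; exists b => //.
  by rewrite -lte_fin -cE; near: b.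
pose a := b / 2.
have a0 : 0 < a by rewrite divr_gt0.
have ab : a < b by rewrite /a; lra.
have c01 x : 0 <= c x <= 1 by rewrite -!lee_fin -cE cdf_ge0 cdf_le1.
have phib0 : 0 < phi (c b).
  by rewrite lt0r phi_neq0 ?phi_ge0 ?cb ?andbT//; case/andP: (c01 b).
apply: (@lt_le_trans _ _
    (\int[@lebesgue_measure R]_(x in `[a, b]) (a * phi (c b))%:E)%E).
  rewrite integral_cst//= lebesgue_measure_itv/= lte_fin ab -EFinB -EFinM.
  by rewrite lte_fin; apply: mulr_gt0; [exact: mulr_gt0|lra].
have ab0 : `[a, b] `<=` (`[0, +oo[ : set R).
  move=> x /=; rewrite !in_itv/= andbT => /andP[ax _].
  by rewrite (le_trans _ ax)// ltW.
apply: (@le_trans _ _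
    (\int[@lebesgue_measure R]_(x in `[a, b]) (x * phi (c x))%:E)%E).
- apply: ge0_le_integral => //.
  + by move=> x _; rewrite lee_fin mulr_ge0// ltW.
  + by apply: measurable_funS (measurable_weighted_phi cE).
  + move=> x /=; rewrite in_itv/= lee_fin => /andP[ax xb].
    have cxb : c x <= c b by rewrite -lee_fin -!cE cdf_nondecreasing.
    rewrite ler_pM ?(ltW a0) ?(ltW phib0)// ler_pM2r ?invr_gt0// lerB//.
    by rewrite ler_pXn2r// nnegrE; have /andP[] := c01 x; have /andP[] := c01 b.
- apply: ge0_subset_integral => //; first exact: measurable_weighted_phi cE.
  by move=> x /=; rewrite in_itv/= andbT lee_fin; exact: (weighted_phi_ge0 cE).
Unshelve. all: by end_near. Qed.

Lemma cdf_nonneg_rv Z x : nonneg_rv Z -> x < 0 -> cdf Z x = 0%E.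
Proof.
move=> Z0 x0; change (P ((Z : Omega -> R) @^-1` `]-oo, x]) = 0%E).
apply: measure_negligible.
  exact: measurable_funPTI.
apply: negligibleS Z0 => w /=; rewrite in_itv/= => Zwx Zw0.
by have := lt_le_trans x0 (le_trans Zw0 Zwx); rewrite ltxx.
Qed.

(** The closed half-line up to 0 is the point 0, null by absolute continuity, together with
    countably many closed half-lines ending below 0, null by hypothesis. *)
Lemma abs_continuous_cdf0 Z : abs_continuous_rv Z ->
  (forall x, x < 0 -> cdf Z x = 0%E) -> cdf Z 0 = 0%E.
Proof.
move=> acZ Z0; apply: measure_negligible => //.
have -> : `]-oo, (0 : R)]%classic =
    [set 0] `|` \bigcup_n `]-oo, (- n.+1%:R^-1)]%classic.
  apply/seteqP; split => x /=; rewrite in_itv/=.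
    rewrite le_eqVlt => /predU1P[->|x0]; first by left.
    right; have [n xn] := ltr_add_invr x0.
    by exists n => //=; rewrite in_itv/= -subr_le0 opprK ltW.
  case=> [->|[n _ /=]]; rewrite ?lexx// in_itv/= => /le_trans; apply.
  by rewrite oppr_le0.
apply: negligibleU; last first.
  apply: negligible_bigcup => n; apply/negligibleP => //.
  by apply: Z0; rewrite oppr_lt0.
apply/negligibleP => //; apply: (acZ [set 0]) => //.
by apply/negligible_null_set/negligibleP => //; exact: lebesgue_measure_set1.
Qed.

End extropy.

(** * The common marginal F of the components *)

Section coherent.
Context (n : nat) (psi : {ffun 'I_n -> bool} -> bool).
Context (d : measure_display) (Omega : measurableType d) (R : realType).
Context (P : probability Omega R).

(** Provides a sample point at which the pointwise relation [system_lifetime] can be evaluated. *)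
Lemma probability_inhabited : exists w : Omega, True.
Proof.
apply: contrapT => h.
have : P setT = P set0.
  by congr (P _); apply/seteqP; split => // w _; apply: h; exists w.
by rewrite probability_setT measure0 => /eqP; rewrite onee_eq0.
Qed.

(* With no component the structure function is constant, whereas the state of
   the system at time t depends on t. *)
Lemma coherent_lifetime_gt0 F (X : 'I_n -> {RV P >-> R}) L :
  coherent_lifetime psi F X L -> (0 < n)%N.
Proof.
case=> _ _ _ XL; rewrite lt0n; apply/eqP => n0.
have [w _] := probability_inhabited.
have psiE s t : psi s = psi t.
  by congr psi; apply/ffunP => -[i iln]; exfalso; move: iln; rewrite n0.
have := XL w (L w); rewrite ltxx => h1; have := XL w (L w - 1).
by rewrite (psiE _ [ffun i => L w < X i w]) -h1; lra.
Qed.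

(** The existence of a component makes F an actual cdf of a nonnegative variable; its values then
    lie in the interval where the distortions are controlled. *)
Lemma coherent_lifetime_marginal F (X : 'I_n -> {RV P >-> R}) L :
    coherent_lifetime psi F X L ->
  (forall x, 0 <= F x <= 1) /\ (forall x, x < 0 -> F x = 0).
Proof.
move=> XL; have n0 := coherent_lifetime_gt0 XL.
case: XL => _ X0 XF _; pose i := Ordinal n0; split => x.
  by rewrite -!lee_fin -(XF i) cdf_ge0 cdf_le1.
move=> x0; apply: EFin_inj; rewrite -(XF i).
exact: cdf_nonneg_rv.
Qed.

End coherent.

(** A quotient exists where [q1] equals 1/2. This excludes an infimum +oo and a supremum -oo. *)
Lemma phi_quotients_nonempty (R : realType) (q1 q2 : R -> R) :
    {within `[0, 1], continuous q1} -> q1 0 = 0 -> q1 1 = 1 ->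
  exists r, phi_quotients q1 q2 r%:E.
Proof.
move=> qc q10 q11.
have h : 0 < (2^-1 : R) < 1 by apply/andP; split; lra.
have [u u01 qu] := continuous_attains_interior qc q10 q11 h.
exists (phi (q2 u) / phi (q1 u)), u => //; split=> //.
by rewrite qu phi_neq0//; lra.
Qed.

(** * Integration of the pointwise bounds *)

Unset Implicit Arguments.

Theorem proposition9 (R : realType)
  (d1 d2 : measure_display)
  (Omega1 : measurableType d1) (Omega2 : measurableType d2)
  (P1 : probability Omega1 R) (P2 : probability Omega2 R)
  (n1 n2 : nat)
  (psi1 : {ffun 'I_n1 -> bool} -> bool) (psi2 : {ffun 'I_n2 -> bool} -> bool)
  (F : R -> R)
  (X1 : 'I_n1 -> {RV P1 >-> R}) (X2 : 'I_n2 -> {RV P2 >-> R})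
  (T1 : {RV P1 >-> R}) (T2 : {RV P2 >-> R})
  (q1 q2 : R -> R)
  (hT1 : coherent_lifetime psi1 F X1 T1)
  (hT2 : coherent_lifetime psi2 F X2 T2)
  (acT1 : abs_continuous_rv T1)
  (acT2 : abs_continuous_rv T2)
  (hq1 : distortion q1 F T1)
  (hq2 : distortion q2 F T2) :
  let D1 := ereal_inf (phi_quotients q1 q2) in
  let D2 := ereal_sup (phi_quotients q1 q2) in
  (D1 * weighted_neg_cumul_extropy T1 <= weighted_neg_cumul_extropy T2 /\
   weighted_neg_cumul_extropy T2 <= D2 * weighted_neg_cumul_extropy T1)%E.
Proof.
move=> D1 D2.
have [F01 F0] := coherent_lifetime_marginal hT1.
case: hq1 => q1nd q1c q10 q11 T1E; case: hq2 => q2nd q2c q20 q21 T2E.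
have [r qr] := phi_quotients_nonempty q2 q1c q10 q11.
have quotient_ge0 x : phi_quotients q1 q2 x -> (0 <= x)%E.
  case=> u [/andP[/ltW u0 /ltW u1] _] <-; rewrite lee_fin divr_ge0//.
    by apply/phi_ge0/homo_itv01 => //; rewrite u0.
  by apply/phi_ge0/homo_itv01 => //; rewrite u0.
have phi_q1_gt0 u : 0 < u < 1 -> phi (q1 u) != 0 -> 0 < phi (q1 u).
  move=> /andP[/ltW u0 /ltW u1]; rewrite lt0r => -> /=.
  by apply/phi_ge0/homo_itv01 => //; rewrite u0.
have pos (x : R) : x \in `[0, +oo[ -> 0 <= x by rewrite in_itv/= andbT.
have mT1 := measurable_weighted_phi T1E.
have mT2 := measurable_weighted_phi T2E.
have T1_ge0 x : `[0, +oo[%classic x -> (0 <= (x * phi (q1 (F x)))%:E)%E.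
  by move=> /pos x0; rewrite lee_fin (weighted_phi_ge0 T1E).
have T2_ge0 x : `[0, +oo[%classic x -> (0 <= (x * phi (q2 (F x)))%:E)%E.
  by move=> /pos x0; rewrite lee_fin (weighted_phi_ge0 T2E).
split.
  have D1_ge0 : (0 <= D1)%E by apply: le_ereal_inf_tmp => x /quotient_ge0.
  have D1_le : (D1 <= r%:E)%E by apply: ereal_inf_lbound.
  have [D D1E] : exists D, D1 = D%:E.
    by case: D1 D1_ge0 D1_le => [D| |]//; exists D.
  have {}D1_le := phi_lower_bound q2nd q1c q10 q11 q20 q21 (D := D).
  rewrite (weighted_neg_cumul_extropyE T1E).
  rewrite (weighted_neg_cumul_extropyE T2E) -ge0_integralZl//.
  apply: ge0_le_integral => //.
  - by move=> x /T1_ge0; exact: mule_ge0.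
  - exact: measurable_funeM.
  - move=> x /pos x0; rewrite D1E -EFinM lee_fin (mulrCA D) ler_wpM2l//.
    apply: D1_le => // u u01 pu; rewrite -ler_pdivlMr ?phi_q1_gt0//.
    by rewrite -lee_fin -D1E; apply: ereal_inf_lbound; exists u.
have D2_ge : (r%:E <= D2)%E by exact: ereal_sup_ubound.
have D2_ge0 := le_trans (quotient_ge0 _ qr) D2_ge.
have [D2E|D2fin] := eqVneq D2 +oo%E.
  (* Strict positivity matters because +oo times 0 is 0 in the extended reals. The cdf of [T1]
     vanishes below 0 because F does and [q1 0 = 0]. *)
  have W0 : (0 < weighted_neg_cumul_extropy T1)%E.
    apply: weighted_neg_cumul_extropy_gt0.
    rewrite abs_continuous_cdf0// => x x0.
    by rewrite T1E F0// q10.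
  by rewrite D2E gt0_mulye// leey.
have [D D2E] : exists D, D2 = D%:E.
  by case: D2 D2_ge D2fin {D2_ge0} => [D| |]//; exists D.
have D2_le := phi_upper_bound q1nd q2nd q1c q2c q10 q11 q20 q21 (D := D).
rewrite (weighted_neg_cumul_extropyE T1E).
rewrite (weighted_neg_cumul_extropyE T2E) -ge0_integralZl//.
apply: ge0_le_integral => //.
- exact: measurable_funeM.
- move=> x /pos x0; rewrite D2E -EFinM lee_fin (mulrCA D) ler_wpM2l//.
  apply: D2_le => // u u01 pu; rewrite -ler_pdivrMr ?phi_q1_gt0//.
  by rewrite -lee_fin -D2E; apply: ereal_sup_ubound; exists u.
Qed.
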